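(* Let $\varphi : R \rightarrow S$ be a faithfully flat homomorphism of commutative rings. Let $\mathcal Q$ be a class of $R$-modules. Let $M$ be an $R$-module such that $M \otimes_R S$ is a flat $(\mathcal Q \otimes_R S)$-Mittag-Leffler $S$-module. Then $M$ is a flat $\mathcal Q$-Mittag-Leffler $R$-module.
   Context: For a commutative ring $T$ and a class $\mathcal E$ of $T$-modules, a $T$-module $N$ is $\mathcal E$-Mittag-Leffler if for every family $(E_i \mid i\in I)$ of elements of $\mathcal E$ the canonical map $N \otimes_T \prod_{i\in I} E_i \to \prod_{i \in I} N\otimes_T E_i$, $x \otimes (e_i)_{i\in I} \mapsto (x\otimes e_i)_{i\in I}$, is injective. For a class $\mathcal Q$ of $R$-modules, $\mathcal Q \otimes_R S$ denotes the class of $S$-modules $\{Q \otimes_R S \mid Q \in \mathcal Q\}$. *)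

(* Defs.v *)
From HB Require Import structures.
From mathcomp Require Import all_boot all_algebra.
From mathcomp Require Import boolp.

Set Implicit Arguments.
Unset Strict Implicit.
Unset Printing Implicit Defensive.

Import GRing.Theory.
Local Open Scope ring_scope.
Local Open Scope quotient_scope.

(* Commutative rings are comPzRingType, so that the zero ring is included. *)

Section TensorProduct.
Variables (T : comPzRingType) (M N : lmodType T).

(* M (x)_T N is the quotient of the free commutative monoid on M * N by the
   usual relations. The formal sum x1 (x) y1 + ... + xn (x) yn is represented by
   the sequence [:: (x1, y1); ...; (xn, yn)], and tensor_eq is the congruence
   generated by commutativity, bilinearity and 0 (x) y = 0. It is a group because
   x (x) y + (- x) (x) y = 0. *)
Inductive tensor_eq : seq (M * N) -> seq (M * N) -> Prop :=
| teq_refl s : tensor_eq s s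
| teq_sym s t : tensor_eq s t -> tensor_eq t s
| teq_trans s t u : tensor_eq s t -> tensor_eq t u -> tensor_eq s u
| teq_cat s s' t t' :
    tensor_eq s s' -> tensor_eq t t' -> tensor_eq (s ++ t) (s' ++ t')
| teq_catC s t : tensor_eq (s ++ t) (t ++ s)
| teq_0l y : tensor_eq [:: (0, y)] [::]
| teq_Dl x x' y : tensor_eq [:: (x + x', y)] [:: (x, y); (x', y)]
| teq_Dr x y y' : tensor_eq [:: (x, y + y')] [:: (x, y); (x, y')]
| teq_Z a x y : tensor_eq [:: (a *: x, y)] [:: (x, a *: y)].

Definition tensor_eqb (s t : seq (M * N)) : bool := `[< tensor_eq s t >].

Lemma tensor_eqb_refl : reflexive tensor_eqb.
Proof. by move=> s; apply/asboolP; exact: teq_refl. Qed.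

Lemma tensor_eqb_sym : symmetric tensor_eqb.
Proof. by move=> s t; apply/asboolP/asboolP; exact: teq_sym. Qed.

Lemma tensor_eqb_trans : transitive tensor_eqb.
Proof.
by move=> t s u /asboolP st /asboolP tu; apply/asboolP; exact: teq_trans tu.
Qed.

Canonical tensor_equiv :=
  EquivRel tensor_eqb tensor_eqb_refl tensor_eqb_sym tensor_eqb_trans.

Definition tensor : Type := {eq_quot tensor_equiv}.
HB.instance Definition _ := Choice.on tensor.

Definition tens_seq (s : seq (M * N)) : tensor := \pi_({eq_quot tensor_equiv}) s.
Definition tens (x : M) (y : N) : tensor := tens_seq [:: (x, y)].

Definition tens_repr (u : tensor) : seq (M * N) :=
  repr (u : {eq_quot tensor_equiv}).

Lemma tens_reprK u : tens_seq (tens_repr u) = u.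
Proof. exact: (@reprK _ {eq_quot tensor_equiv}). Qed.

Lemma tens_seqP s t : tens_seq s = tens_seq t <-> tensor_eq s t.
Proof.
rewrite /tens_seq; split; first by move/eqP; rewrite eqmodE => /asboolP.
by move=> st; apply/eqP; rewrite eqmodE; apply/asboolP.
Qed.

Lemma tens_repr_eq s : tensor_eq (tens_repr (tens_seq s)) s.
Proof. by apply/tens_seqP; rewrite tens_reprK. Qed.

Definition tensor_add (u v : tensor) := tens_seq (tens_repr u ++ tens_repr v).
Definition tensor_opp (u : tensor) :=
  tens_seq [seq (- p.1, p.2) | p <- tens_repr u].

Lemma tensor_add_seq s t :
  tensor_add (tens_seq s) (tens_seq t) = tens_seq (s ++ t).
Proof. by apply/tens_seqP; apply: teq_cat; exact: tens_repr_eq. Qed.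

Lemma tensor_addA : associative tensor_add.
Proof.
move=> u v w; rewrite -(tens_reprK u) -(tens_reprK v) -(tens_reprK w).
by rewrite !tensor_add_seq catA.
Qed.

Lemma tensor_addC : commutative tensor_add.
Proof.
move=> u v; rewrite -(tens_reprK u) -(tens_reprK v) !tensor_add_seq.
by apply/tens_seqP; exact: teq_catC.
Qed.

Lemma tensor_add0 : left_id (tens_seq [::]) tensor_add.
Proof. by move=> u; rewrite -(tens_reprK u) tensor_add_seq. Qed.

Lemma tensor_addN : left_inverse (tens_seq [::]) tensor_opp tensor_add.
Proof.
move=> u; rewrite -{2}(tens_reprK u) /tensor_opp tensor_add_seq.
apply/tens_seqP; elim: (tens_repr u) => [|[x y] s IHs] /=; first exact: teq_refl.
pose a := [:: (- x, y)]; pose b := [:: (x, y)].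
set c := map _ s; change (tensor_eq (a ++ (c ++ (b ++ s))) [::]).
have ab0 : tensor_eq (a ++ b) [::].
  apply: teq_trans (teq_0l y); apply: teq_sym.
  by rewrite -(addNr x); exact: teq_Dl.
have h : tensor_eq (c ++ (b ++ s)) (b ++ (c ++ s)).
  by rewrite !catA; apply: teq_cat (teq_refl _); exact: teq_catC.
apply: teq_trans (teq_cat (teq_refl a) h) _.
by rewrite catA -[[::]]/([::] ++ [::]); exact: teq_cat.
Qed.

HB.instance Definition _ := GRing.isZmodule.Build tensor
  tensor_addA tensor_addC tensor_add0 tensor_addN.

Lemma tens_seqD s t : tens_seq (s ++ t) = tens_seq s + tens_seq t.
Proof. by rewrite -tensor_add_seq. Qed.

Lemma tens_seqE s : tens_seq s = \sum_(p <- s) tens p.1 p.2.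
Proof.
elim: s => [|[x y] s IHs]; first by rewrite big_nil.
by rewrite big_cons -cat1s tens_seqD IHs.
Qed.

Lemma tensor_ind_tens (P : tensor -> Prop) :
  P 0 -> (forall x y u, P u -> P (tens x y + u)) -> forall u, P u.
Proof.
move=> P0 PD u; rewrite -(tens_reprK u) tens_seqE.
by elim: (tens_repr u) => [|p s IHs]; rewrite ?big_nil ?big_cons //; apply: PD.
Qed.

Lemma tensDl x x' y : tens (x + x') y = tens x y + tens x' y.
Proof. by rewrite /tens -tens_seqD; apply/tens_seqP; exact: teq_Dl. Qed.

Lemma tensDr x y y' : tens x (y + y') = tens x y + tens x y'.
Proof. by rewrite /tens -tens_seqD; apply/tens_seqP; exact: teq_Dr. Qed.

Lemma tensZ a x y : tens (a *: x) y = tens x (a *: y).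
Proof. by apply/tens_seqP; exact: teq_Z. Qed.

Definition balanced (P : zmodType) (b : M -> N -> P) : Prop :=
  [/\ forall x x' y, b (x + x') y = b x y + b x' y,
      forall x y y', b x (y + y') = b x y + b x y'
    & forall a x y, b (a *: x) y = b x (a *: y)].

(* The additive map with x (x) y |-> b x y; only meaningful if b is balanced. *)
Definition tensor_lift (P : zmodType) (b : M -> N -> P) (u : tensor) : P :=
  \sum_(p <- tens_repr u) b p.1 p.2.

Section Lift.
Variables (P : zmodType) (b : M -> N -> P).
Hypothesis b_bal : balanced b.

Lemma tensor_lift_seq s : tensor_lift b (tens_seq s) = \sum_(p <- s) b p.1 p.2.
Proof.
have [bDl bDr bZ] := b_bal.
have b0 y : b 0 y = 0 by apply: (addIr (b 0 y)); rewrite -bDl !add0r.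
rewrite /tensor_lift; move: (tens_repr _) (tens_repr_eq s) => r.
elim=> {r s} //.
- by move=> s t u _ -> _ ->.
- by move=> s s' t t' _ IHs _ IHt; rewrite !big_cat /= IHs IHt.
- by move=> s t; rewrite !big_cat /= addrC.
- by move=> y; rewrite big_seq1 big_nil /= b0.
- by move=> x x' y; rewrite !big_cons !big_nil /= bDl !addr0.
- by move=> x y y'; rewrite !big_cons !big_nil /= bDr !addr0.
- by move=> a x y; rewrite !big_seq1 /= bZ.
Qed.

Lemma tensor_lift_tens x y : tensor_lift b (tens x y) = b x y.
Proof. by rewrite tensor_lift_seq big_seq1. Qed.

Lemma tensor_liftD u v :
  tensor_lift b (u + v) = tensor_lift b u + tensor_lift b v.
Proof.
rewrite -(tens_reprK u) -(tens_reprK v) -tens_seqD.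
by rewrite !tensor_lift_seq big_cat.
Qed.

Lemma tensor_lift0 : tensor_lift b 0 = 0.
Proof. by apply: (addIr (tensor_lift b 0)); rewrite -tensor_liftD !add0r. Qed.

End Lift.

Lemma balanced_tens_scale a : balanced (fun x y => tens (a *: x) y).
Proof.
split=> [x x' y|x y y'|c x y]; rewrite ?scalerDr ?tensDl ?tensDr //.
by rewrite scalerA mulrC -scalerA tensZ.
Qed.

Definition tensor_scale (a : T) : tensor -> tensor :=
  tensor_lift (fun x y => tens (a *: x) y).

Let tsD a := tensor_liftD (balanced_tens_scale a).
Let ts0 a := tensor_lift0 (balanced_tens_scale a).
Let tsE a := tensor_lift_tens (balanced_tens_scale a).

Lemma tensor_scaleA a b u :
  tensor_scale a (tensor_scale b u) = tensor_scale (a * b) u.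
Proof.
elim/tensor_ind_tens: u => [|x y u IHu]; rewrite /tensor_scale ?ts0 //.
by rewrite !tsD !tsE -!/(tensor_scale _ _) IHu scalerA.
Qed.

Lemma tensor_scale1 : left_id 1 tensor_scale.
Proof.
elim/tensor_ind_tens => [|x y u IHu]; rewrite /tensor_scale ?ts0 //.
by rewrite tsD tsE -/(tensor_scale _ _) IHu scale1r.
Qed.

Lemma tensor_scaleDr : right_distributive tensor_scale +%R.
Proof. by move=> a u v; rewrite /tensor_scale tsD. Qed.

Lemma tensor_scaleDl u : {morph tensor_scale^~ u : a b / a + b}.
Proof.
move=> a b; elim/tensor_ind_tens: u => [|x y u IHu].
  by rewrite /tensor_scale !ts0 addr0.
rewrite /tensor_scale !tsD !tsE -!/(tensor_scale _ _) IHu.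
by rewrite scalerDl tensDl addrACA.
Qed.

HB.instance Definition _ := GRing.Zmodule_isLmodule.Build T tensor
  tensor_scaleA tensor_scale1 tensor_scaleDr tensor_scaleDl.

Lemma tensZl a x y : tens (a *: x) y = a *: tens x y.
Proof. by rewrite /GRing.scale /= /tensor_scale tsE. Qed.

Lemma tensZr a x y : tens x (a *: y) = a *: tens x y.
Proof. by rewrite -tensZ tensZl. Qed.

End TensorProduct.

Section TensorMap.
Variables (T : comPzRingType) (N A B : lmodType T).

Definition tensor_map (f : A -> B) : tensor N A -> tensor N B :=
  tensor_lift (fun x a => tens x (f a)).

Variable f : {linear A -> B}.

Lemma balanced_tensor_map : balanced (fun (x : N) a => tens x (f a)).
Proof.
split=> [x x' y|x y y'|c x y]; first by rewrite tensDl.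
- by rewrite linearD tensDr.
- by rewrite linearZ /= tensZ.
Qed.

Lemma tensor_map_tens x a : tensor_map f (tens x a) = tens x (f a).
Proof. exact: tensor_lift_tens balanced_tensor_map _ _. Qed.

Lemma tensor_map_linear : linear (tensor_map f).
Proof.
move=> a u v; rewrite /tensor_map (tensor_liftD balanced_tensor_map).
congr (_ + _); rewrite -/(tensor_map f); elim/tensor_ind_tens: u => [|x y u IHu].
  by rewrite scaler0 /tensor_map (tensor_lift0 balanced_tensor_map) scaler0.
rewrite scalerDr -tensZl /tensor_map !(tensor_liftD balanced_tensor_map).
by rewrite -/(tensor_map f) !tensor_map_tens IHu scalerDr tensZl.
Qed.

HB.instance Definition _ :=
  GRing.isLinear.Build T (tensor N A) (tensor N B) _ (tensor_map f)
    tensor_map_linear.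

End TensorMap.

Arguments tensor_map {T} N {A B} f _.

Definition exact_at (T : pzRingType) (A B C : lmodType T)
    (f : {linear A -> B}) (g : {linear B -> C}) : Prop :=
  forall y, g y = 0 <-> exists x, f x = y.

Definition flat (T : comPzRingType) (N : lmodType T) : Prop :=
  forall (A B C : lmodType T) (f : {linear A -> B}) (g : {linear B -> C}),
    exact_at f g -> exact_at (tensor_map N f) (tensor_map N g).

Definition faithfully_flat (T : comPzRingType) (N : lmodType T) : Prop :=
  forall (A B C : lmodType T) (f : {linear A -> B}) (g : {linear B -> C}),
    exact_at f g <-> exact_at (tensor_map N f) (tensor_map N g).

Section ProductModule.
Variables (T : pzRingType) (I : Type) (E : I -> lmodType T).

Definition prod_module : Type := forall i, E i.
HB.instance Definition _ := gen_eqMixin prod_module.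
HB.instance Definition _ := gen_choiceMixin prod_module.

Implicit Types e : prod_module.

Let add e e' : prod_module := fun i => e i + e' i.
Let opp e : prod_module := fun i => - e i.
Let scale (a : T) e : prod_module := fun i => a *: e i.

Let addA : associative add.
Proof. by move=> e e' e''; apply: functional_extensionality_dep => i; apply: addrA. Qed.
Let addC : commutative add.
Proof. by move=> e e'; apply: functional_extensionality_dep => i; apply: addrC. Qed.
Let add0 : left_id (fun=> 0) add.
Proof. by move=> e; apply: functional_extensionality_dep => i; apply: add0r. Qed.
Let addN : left_inverse (fun=> 0) opp add.
Proof. by move=> e; apply: functional_extensionality_dep => i; apply: addNr. Qed.

HB.instance Definition _ := GRing.isZmodule.Build prod_module
  addA addC add0 addN.

Let scaleA a b e : scale a (scale b e) = scale (a * b) e.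
Proof. by apply: functional_extensionality_dep => i; apply: scalerA. Qed.
Let scale1 : left_id 1 scale.
Proof. by move=> e; apply: functional_extensionality_dep => i; apply: scale1r. Qed.
Let scaleDr : right_distributive scale +%R.
Proof. by move=> a e e'; apply: functional_extensionality_dep => i; apply: scalerDr. Qed.
Let scaleDl e : {morph scale^~ e : a b / a + b}.
Proof. by move=> a b; apply: functional_extensionality_dep => i; apply: scalerDl. Qed.

HB.instance Definition _ := GRing.Zmodule_isLmodule.Build T prod_module
  scaleA scale1 scaleDr scaleDl.

Lemma prod_moduleD e e' i : (e + e') i = e i + e' i. Proof. by []. Qed.
Lemma prod_moduleZ a e i : (a *: e) i = a *: e i. Proof. by []. Qed.

End ProductModule.

Section MittagLeffler.
Variables (T : comPzRingType) (N : lmodType T).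

Definition tensor_prod_map (I : Type) (E : I -> lmodType T) :
    tensor N (prod_module E) -> prod_module (fun i => tensor N (E i)) :=
  tensor_lift (fun (x : N) (e : prod_module E) =>
    (fun i => tens x (e i)) : prod_module (fun i => tensor N (E i))).

Lemma tensor_prod_map_tens (I : Type) (E : I -> lmodType T) x e i :
  @tensor_prod_map I E (tens x e) i = tens x (e i).
Proof.
rewrite /tensor_prod_map tensor_lift_tens //.
split=> [y y' f|y f f'|a y f]; apply: functional_extensionality_dep => j.
- exact: tensDl.
- exact: tensDr.
- exact: tensZ.
Qed.

Definition mittag_leffler (cE : lmodType T -> Prop) : Prop :=
  forall (I : Type) (E : I -> lmodType T),
    (forall i, cE (E i)) -> injective (@tensor_prod_map I E).

End MittagLeffler.

Arguments tensor_prod_map {T} N {I} E _ _.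

Section BaseChange.
Variables (R S : comPzRingType) (phi : {rmorphism R -> S}).

(* S as an R-module along phi *)
Definition restr_ring of {rmorphism R -> S} : Type := S.
HB.instance Definition _ := GRing.Zmodule.on (restr_ring phi).

Let rscale (a : R) (s : restr_ring phi) : restr_ring phi := phi a * (s : S).

Let rscaleA a b s : rscale a (rscale b s) = rscale (a * b) s.
Proof. by rewrite /rscale rmorphM mulrA. Qed.
Let rscale1 : left_id 1 rscale.
Proof. by move=> s; rewrite /rscale rmorph1 mul1r. Qed.
Let rscaleDr : right_distributive rscale +%R.
Proof. by move=> a s s'; rewrite /rscale mulrDr. Qed.
Let rscaleDl s : {morph rscale^~ s : a b / a + b}.
Proof. by move=> a b; rewrite /rscale rmorphD mulrDl. Qed.

HB.instance Definition _ := GRing.Zmodule_isLmodule.Build R (restr_ring phi)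
  rscaleA rscale1 rscaleDr rscaleDl.

Lemma restr_ringZ a (s : restr_ring phi) : a *: s = phi a * (s : S) :> S.
Proof. by []. Qed.

Variable M : lmodType R.

(* M (x)_R S as an S-module: s *: (x (x) s') = x (x) (s * s') *)
Definition base_change : Type := tensor M (restr_ring phi).
HB.instance Definition _ := GRing.Zmodule.on base_change.

Definition base_change_tens (x : M) (s : S) : base_change :=
  tens x (s : restr_ring phi).

Lemma balanced_base_change_scale (s : S) :
  balanced (fun (x : M) (s' : restr_ring phi) => base_change_tens x (s * s')).
Proof.
split=> [x x' t|x t t'|a x t]; first exact: tensDl.
- by rewrite mulrDr; exact: tensDr.
- by rewrite restr_ringZ mulrCA; exact: tensZ.
Qed.

Definition base_change_scale (s : S) : base_change -> base_change :=
  tensor_lift (fun (x : M) (s' : restr_ring phi) => base_change_tens x (s * s')).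

Let bsD s := tensor_liftD (balanced_base_change_scale s).
Let bs0 s := tensor_lift0 (balanced_base_change_scale s).
Let bsE s := tensor_lift_tens (balanced_base_change_scale s).

Lemma base_change_scaleA a b u :
  base_change_scale a (base_change_scale b u) = base_change_scale (a * b) u.
Proof.
rewrite /base_change_scale; elim/tensor_ind_tens: u => [|x y u IHu].
  by rewrite !bs0.
by rewrite !bsD !bsE IHu mulrA.
Qed.

Lemma base_change_scale1 : left_id 1 base_change_scale.
Proof.
rewrite /base_change_scale; elim/tensor_ind_tens => [|x y u IHu].
  by rewrite bs0.
by rewrite bsD bsE IHu mul1r.
Qed.

Lemma base_change_scaleDr : right_distributive base_change_scale +%R.
Proof. by move=> a u v; exact: bsD. Qed.

Lemma base_change_scaleDl u : {morph base_change_scale^~ u : a b / a + b}.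
Proof.
move=> a b; rewrite /base_change_scale.
elim/tensor_ind_tens: u => [|x y u IHu]; first by rewrite !bs0 addr0.
by rewrite !bsD !bsE IHu mulrDl /base_change_tens tensDr addrACA.
Qed.

HB.instance Definition _ := GRing.Zmodule_isLmodule.Build S base_change
  base_change_scaleA base_change_scale1 base_change_scaleDr base_change_scaleDl.

Lemma base_changeZ a x s :
  a *: base_change_tens x s = base_change_tens x (a * s).
Proof. exact: bsE. Qed.

End BaseChange.

Definition base_change_class (R S : comPzRingType) (phi : {rmorphism R -> S})
    (cQ : lmodType R -> Prop) : lmodType S -> Prop :=
  fun E => exists2 Q, cQ Q & E = base_change phi Q.

Definition faithfully_flat_morphism (R S : comPzRingType)
    (phi : {rmorphism R -> S}) : Prop :=
  faithfully_flat (restr_ring phi : lmodType R).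

(* Main.v *)
Require Import Defs.
From HB Require Import structures.
From mathcomp Require Import all_boot all_algebra.
From mathcomp Require Import boolp.

(** Write [M_S] for the base change of [M] along [phi], with its [S]-action, and
    let every [S]-module be an [R]-module by restriction along [phi].  Both
    conclusions come from the isomorphism of [M (x)_R P] with [M_S (x)_S P],
    natural in the [S]-module [P] ([base_change_cancelK] and
    [base_change_uncancelK]), which turns hypotheses on [M_S] into statements
    about tensoring [M] with [S]-modules.

    Flatness ([flat_descent]).  An exact sequence [A -> B -> C] over [R] stays
    exact after base change to [S] ([base_change_exact]), hence after tensoring
    with the flat [S]-module [M_S].  As [M_S (x)_S A_S] is [M (x)_R A_S], which
    is [S (x)_R (M (x)_R A)] ([shuffleK], [unshuffleK]), the sequence
    [M (x) A -> M (x) B -> M (x) C] is exact after tensoring with [S], so it is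
    exact by faithful flatness.

    The Mittag-Leffler property ([mittag_leffler_descent]).  The map from
    the base change of [prod Q_i] to [prod (Q_i)_S] need not be injective, so
    base changing [M (x) prod Q_i -> prod (M (x) Q_i)] does not reduce it to the
    hypothesis on [M_S].  Instead, embed [prod Q_i] itself into [prod (Q_i)_S],
    coordinatewise by the units [Q_i -> (Q_i)_S].  These are injective
    ([base_change_unit_inj]), so the flat module [M] yields an embedding of
    [M (x)_R prod Q_i] into [M (x)_R prod (Q_i)_S], which is
    [M_S (x)_S prod (Q_i)_S] and embeds in the product of the
    [M_S (x)_S (Q_i)_S] by hypothesis.  The composite factors through
    [prod (M (x)_R Q_i)], so the first factor is injective too. *)

Set Implicit Arguments.
Unset Strict Implicit.
Unset Printing Implicit Defensive.

Import GRing.Theory.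
Local Open Scope ring_scope.

(** * Additive maps out of tensor products *)

Section TensorAdditive.
Variables (T : comPzRingType) (M N : lmodType T) (P : zmodType).

(** Carrying the proof of balancedness in the argument lets the lift have a
    canonical additive structure. *)
Definition tensor_bilift (b : M -> N -> P) of balanced b : tensor M N -> P :=
  tensor_lift b.

Section Bilift.
Variables (b : M -> N -> P) (b_bal : balanced b).

Fact tensor_bilift_zmod_morphism : zmod_morphism (tensor_bilift b_bal).
Proof.
move=> u v; apply: (addIr (tensor_lift b v)).
by rewrite /tensor_bilift -(tensor_liftD b_bal) !subrK.
Qed.

HB.instance Definition _ :=
  GRing.isZmodMorphism.Build _ _ (tensor_bilift b_bal)
    tensor_bilift_zmod_morphism.

Lemma tensor_bilift_tens x y : tensor_bilift b_bal (tens x y) = b x y.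
Proof. exact: tensor_lift_tens. Qed.

End Bilift.

Lemma tensor_ext (f g : {additive tensor M N -> P}) :
  (forall x y, f (tens x y) = g (tens x y)) -> f =1 g.
Proof.
move=> fg; elim/tensor_ind_tens => [|x y u IHu]; first by rewrite !raddf0.
by rewrite !raddfD fg IHu.
Qed.

Lemma tens0l (y : N) : tens (0 : M) y = 0.
Proof. by rewrite -(scale0r 0) tensZl scale0r. Qed.

Lemma tens0r (x : M) : tens x (0 : N) = 0.
Proof. by rewrite -(scale0r 0) tensZr scale0r. Qed.

End TensorAdditive.

Lemma tensor_ext_assoc (T : comPzRingType) (L M N : lmodType T) (P : zmodType)
    (f g : {additive tensor L (tensor M N) -> P}) :
  (forall z x y, f (tens z (tens x y)) = g (tens z (tens x y))) -> f =1 g.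
Proof.
move=> fg; apply: tensor_ext => z u; elim/tensor_ind_tens: u => [|x y u IHu].
  by rewrite tens0r !raddf0.
by rewrite tensDr !raddfD fg IHu.
Qed.

(** * Exact sequences and injectivity *)

Section Exactness.

(** The two sequences may live over different rings, and the vertical bijections
    are mere functions, so that an isomorphism between an [R]-module and an
    [S]-module can be used without comparing the two scalar actions. *)
Lemma exact_at_bij (T T' : comPzRingType) (A B C : lmodType T)
    (A' B' C' : lmodType T') (f : {linear A -> B}) (g : {linear B -> C})
    (f' : {linear A' -> B'}) (g' : {linear B' -> C'})
    (a : A -> A') (b : B -> B') (c : C -> C') :
  bijective a -> bijective b -> bijective c -> c 0 = 0 ->
  (forall x, f' (a x) = b (f x)) -> (forall y, g' (b y) = c (g y)) ->
  exact_at f g <-> exact_at f' g'.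
Proof.
move=> [a1 aK a1K] [b1 bK b1K] /bij_inj c_inj c0 f'a g'b.
have kerE y : g' (b y) = 0 <-> g y = 0.
  by rewrite g'b -[X in _ = X]c0; split=> [/c_inj|->].
have imE y : (exists x, f' x = b y) <-> (exists x, f x = y).
  split=> -[x fx]; last by exists (a x); rewrite f'a fx.
  by exists (a1 x); apply: (can_inj bK); rewrite -f'a a1K.
split=> fg y; first by rewrite -(b1K y) kerE imE.
by rewrite -kerE -imE.
Qed.

Variable T : comPzRingType.

(** Flatness speaks of exact sequences only; this is how it reaches injective
    maps. *)
Lemma exact_at0P (A B C : lmodType T) (f : {linear A -> B})
    (g : {linear B -> C}) : (forall x, f x = 0) -> exact_at f g <-> injective g.
Proof.
move=> f0; split=> [fg|g_inj y].
  by apply: raddf_inj => y /fg [x <-].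
split=> [gy0|[x <-]]; last by rewrite f0 raddf0.
by exists 0; rewrite raddf0; apply: g_inj; rewrite gy0 raddf0.
Qed.

Lemma tensor_map0 (N A B : lmodType T) (f : {linear A -> B}) :
  (forall x, f x = 0) -> forall u, tensor_map N f u = 0.
Proof.
move=> f0; elim/tensor_ind_tens => [|x y u IHu]; first exact: raddf0.
by rewrite raddfD /= tensor_map_tens f0 tens0r IHu addr0.
Qed.

Variables (N B C : lmodType T) (g : {linear B -> C}).

Lemma flat_inj : flat N -> injective g -> injective (tensor_map N g).
Proof.
move=> flatN /(exact_at0P (f := (\0 : {linear B -> B})) g (fun=> erefl)).
by move=> /flatN /exact_at0P; apply; apply: tensor_map0.
Qed.

Lemma faithfully_flat_inj :
  faithfully_flat N -> injective (tensor_map N g) -> injective g.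
Proof.
move=> ffN Ng_inj; apply/(exact_at0P (f := (\0 : {linear B -> B})) g) => //.
by apply/ffN/exact_at0P => //; apply: tensor_map0.
Qed.

End Exactness.

Lemma faithfully_flat_flat (T : comPzRingType) (N : lmodType T) :
  faithfully_flat N -> flat N.
Proof. by move=> ffN A B C f g /ffN. Qed.

Section TensorProdMap.
Variables (T : comPzRingType) (N : lmodType T) (I : Type) (E : I -> lmodType T).

Fact tensor_prod_map_zmod_morphism : zmod_morphism (tensor_prod_map N E).
Proof.
apply: tensor_bilift_zmod_morphism.
split=> [y y' e|y e e'|a y e]; apply: functional_extensionality_dep => j.
- exact: tensDl.
- exact: tensDr.
- exact: tensZ.
Qed.

HB.instance Definition _ :=
  GRing.isZmodMorphism.Build _ _ (tensor_prod_map N E)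
    tensor_prod_map_zmod_morphism.

End TensorProdMap.

(** * Symmetry of the tensor product *)

Section TensorSwap.
Variables (T : comPzRingType) (M N : lmodType T).

Fact balanced_swap : balanced (fun (x : M) (y : N) => tens y x).
Proof.
by split=> [x x' y|x y y'|a x y]; rewrite ?tensDl ?tensDr ?tensZ.
Qed.

Definition tensor_swap := tensor_bilift balanced_swap.
HB.instance Definition _ := GRing.Additive.on tensor_swap.

Lemma tensor_swap_tens x y : tensor_swap (tens x y) = tens y x.
Proof. exact: tensor_bilift_tens. Qed.

End TensorSwap.
Arguments tensor_swap {T} M N.

Lemma tensor_swapK (T : comPzRingType) (M N : lmodType T) :
  cancel (tensor_swap M N) (tensor_swap N M).
Proof.
apply: (tensor_ext (f := tensor_swap N M \o tensor_swap M N) (g := idfun)).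
by move=> x y /=; rewrite !tensor_swap_tens.
Qed.

(** * Restriction of scalars *)

Section Restriction.
Variables (R S : comPzRingType) (phi : {rmorphism R -> S}) (P : lmodType S).

(** Indexing the type by [phi] gives each ring morphism its own [R]-module
    structure on the common carrier [P]. *)
Definition restr_mod of {rmorphism R -> S} : Type := P.
HB.instance Definition _ := GRing.Zmodule.on (restr_mod phi).

Let rscale (a : R) (p : restr_mod phi) : restr_mod phi := phi a *: (p : P).

Let rscaleA a b p : rscale a (rscale b p) = rscale (a * b) p.
Proof. by rewrite /rscale rmorphM scalerA. Qed.
Let rscale1 : left_id 1 rscale.
Proof. by move=> p; rewrite /rscale rmorph1 scale1r. Qed.
Let rscaleDr : right_distributive rscale +%R.
Proof. by move=> a p q; rewrite /rscale scalerDr. Qed.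
Let rscaleDl p : {morph rscale^~ p : a b / a + b}.
Proof. by move=> a b; rewrite /rscale rmorphD scalerDl. Qed.

HB.instance Definition _ := GRing.Zmodule_isLmodule.Build R (restr_mod phi)
  rscaleA rscale1 rscaleDr rscaleDl.

Lemma restr_modZ a (p : restr_mod phi) : a *: p = phi a *: (p : P) :> P.
Proof. by []. Qed.

End Restriction.

(** * Base change of modules and of linear maps *)

Section BaseChange.
Variables (R S : comPzRingType) (phi : {rmorphism R -> S}).

Local Notation S_R := (restr_ring phi : lmodType R).
Local Notation bc A := (base_change phi A : lmodType S).
Local Notation res P := (restr_mod P phi : lmodType R).
Local Notation "x ⊠ s" := (base_change_tens phi x s) (at level 40).

Lemma base_change_tensDl (A : lmodType R) (x x' : A) s :
  (x + x') ⊠ s = x ⊠ s + x' ⊠ s.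
Proof. exact: tensDl. Qed.

Lemma base_change_tensDr (A : lmodType R) (x : A) s s' :
  x ⊠ (s + s') = x ⊠ s + x ⊠ s'.
Proof. exact: tensDr. Qed.

Lemma base_change_tensZ (A : lmodType R) a (x : A) s :
  (a *: x) ⊠ s = phi a *: (x ⊠ s).
Proof. by rewrite base_changeZ; exact: tensZ. Qed.

Lemma base_change_scale_tens1 (A : lmodType R) (x : A) s :
  s *: (x ⊠ 1) = x ⊠ s.
Proof. by rewrite base_changeZ mulr1. Qed.

(** Additive maps on [base_change] carry the group structure under that name and
    not under [tensor], so [tensor_ext] does not unify with them. *)
Lemma base_change_ext (A : lmodType R) (P : zmodType)
    (f g : {additive bc A -> P}) :
  (forall x s, f (x ⊠ s) = g (x ⊠ s)) -> f =1 g.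
Proof.
move=> fg; elim/tensor_ind_tens => [|x s u IHu].
  by rewrite (raddf0 f) (raddf0 g).
by rewrite (raddfD f) (raddfD g) fg IHu.
Qed.

Section Map.
Variables (A B : lmodType R) (f : {linear A -> B}).

Fact balanced_base_change_map :
  balanced (fun (x : A) (s : restr_ring phi) => f x ⊠ s).
Proof.
split=> [x x' s|x s s'|a x s]; rewrite ?linearD.
- by rewrite base_change_tensDl.
- by rewrite base_change_tensDr.
- by rewrite linearZ /= base_change_tensZ base_changeZ.
Qed.

Definition base_change_map : bc A -> bc B :=
  tensor_bilift balanced_base_change_map.
HB.instance Definition _ := GRing.Additive.on base_change_map.

Lemma base_change_map_tens x s : base_change_map (x ⊠ s) = f x ⊠ s.
Proof. exact: tensor_bilift_tens. Qed.

Fact base_change_map_scalable : scalable base_change_map.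
Proof.
move=> a; apply: (base_change_ext
  (f := base_change_map \o ( *:%R a)) (g := ( *:%R a) \o base_change_map)).
by move=> x s /=; rewrite base_changeZ !base_change_map_tens base_changeZ.
Qed.

HB.instance Definition _ :=
  GRing.isScalable.Build S (bc A) (bc B) _ base_change_map
    base_change_map_scalable.
End Map.

(** * Cancellation: M (x)_R P is M_S (x)_S P for an S-module P *)

Section Cancel.
Variables (M : lmodType R) (P : lmodType S).

Fact balanced_cancel :
  balanced (fun (x : M) (p : res P) => tens (x ⊠ 1 : bc M) (p : P)).
Proof.
split=> [x x' p|x p p'|a x p]; rewrite ?base_change_tensDl ?tensDl ?tensDr //.
by rewrite base_change_tensZ tensZ.
Qed.

Definition base_change_cancel : tensor M (res P) -> tensor (bc M) P :=
  tensor_bilift balanced_cancel.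
HB.instance Definition _ := GRing.Additive.on base_change_cancel.

Lemma base_change_cancel_tens x p :
  base_change_cancel (tens x p) = tens (x ⊠ 1 : bc M) (p : P).
Proof. exact: tensor_bilift_tens. Qed.

(** A map out of an iterated tensor product is built one factor at a time; here
    [x (x) s (x) p |-> x (x) s *: p] with [p] fixed first. *)
Fact balanced_uncancel_at (p : P) :
  balanced (fun (x : M) (s : restr_ring phi) => tens x (s *: p : res P)).
Proof.
split=> [x x' s|x s s'|a x s]; first by rewrite tensDl.
- by rewrite -tensDr scalerDl.
- by rewrite tensZ restr_modZ scalerA.
Qed.

Definition base_change_uncancel_at (p : P) : bc M -> tensor M (res P) :=
  tensor_bilift (balanced_uncancel_at p).
HB.instance Definition _ p := GRing.Additive.on (base_change_uncancel_at p).

Lemma base_change_uncancel_at_tens p x s :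
  base_change_uncancel_at p (x ⊠ s) = tens x (s *: p : res P).
Proof. exact: tensor_bilift_tens. Qed.

Fact balanced_uncancel : balanced (fun v p => base_change_uncancel_at p v).
Proof.
split=> [v v' p|v p p'|a v p]; first exact: raddfD.
- apply: (base_change_ext (f := base_change_uncancel_at (p + p'))
    (g := base_change_uncancel_at p \+ base_change_uncancel_at p')) v => x s /=.
  by rewrite !base_change_uncancel_at_tens scalerDr -tensDr.
- apply: (base_change_ext (f := base_change_uncancel_at p \o ( *:%R a))
    (g := base_change_uncancel_at (a *: p))) v => x s /=.
  by rewrite base_changeZ !base_change_uncancel_at_tens scalerA mulrC.
Qed.

Definition base_change_uncancel : tensor (bc M) P -> tensor M (res P) :=
  tensor_bilift balanced_uncancel.
HB.instance Definition _ := GRing.Additive.on base_change_uncancel.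

Lemma base_change_uncancel_tens x s p :
  base_change_uncancel (tens (x ⊠ s : bc M) p) = tens x (s *: p : res P).
Proof.
by rewrite /base_change_uncancel tensor_bilift_tens base_change_uncancel_at_tens.
Qed.

Lemma base_change_cancelK : cancel base_change_cancel base_change_uncancel.
Proof.
apply: (tensor_ext (f := base_change_uncancel \o base_change_cancel)
  (g := idfun)) => x p /=.
by rewrite base_change_cancel_tens base_change_uncancel_tens scale1r.
Qed.

Lemma base_change_uncancelK : cancel base_change_uncancel base_change_cancel.
Proof.
apply: (tensor_ext (f := base_change_cancel \o base_change_uncancel)
  (g := idfun)) => v p.
elim/tensor_ind_tens: v => [|x s v IHv]; first by rewrite tens0l !raddf0.
rewrite tensDl !raddfD IHv /=; congr (_ + _).
rewrite base_change_uncancel_tens base_change_cancel_tens -tensZ.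
by rewrite base_change_scale_tens1.
Qed.

End Cancel.

(** * Shuffle: S (x)_R (M (x)_R A) is M (x)_R A_S *)

Section Shuffle.
Variables (M A : lmodType R).

Fact balanced_shuffle_at (s : S) :
  balanced (fun (x : M) (a : A) => tens x (a ⊠ s : res (bc A))).
Proof.
split=> [x x' a|x a a'|c x a]; first by rewrite tensDl.
- by rewrite -tensDr base_change_tensDl.
- by rewrite tensZ base_change_tensZ.
Qed.

Definition shuffle_at (s : S) : tensor M A -> tensor M (res (bc A)) :=
  tensor_bilift (balanced_shuffle_at s).
HB.instance Definition _ s := GRing.Additive.on (shuffle_at s).

Lemma shuffle_at_tens s x a :
  shuffle_at s (tens x a) = tens x (a ⊠ s : res (bc A)).
Proof. exact: tensor_bilift_tens. Qed.

Fact balanced_shuffle :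
  balanced (fun (s : restr_ring phi) u => shuffle_at s u).
Proof.
split=> [s s' u|s u u'|c s u]; last 2 first.
- exact: raddfD.
- apply: (tensor_ext (f := shuffle_at (c *: s))
    (g := shuffle_at s \o ( *:%R c))) u => x a /=.
  by rewrite -tensZr !shuffle_at_tens base_change_tensZ base_changeZ.
apply: (tensor_ext (f := shuffle_at (s + s'))
  (g := shuffle_at s \+ shuffle_at s')) u => x a /=.
by rewrite !shuffle_at_tens -tensDr -base_change_tensDr.
Qed.

Definition shuffle : tensor S_R (tensor M A) -> tensor M (res (bc A)) :=
  tensor_bilift balanced_shuffle.
HB.instance Definition _ := GRing.Additive.on shuffle.

Lemma shuffle_tens (s : S_R) x a :
  shuffle (tens s (tens x a)) = tens x (a ⊠ s : res (bc A)).
Proof. by rewrite /shuffle tensor_bilift_tens shuffle_at_tens. Qed.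

Fact balanced_unshuffle_at (x : M) :
  balanced (fun (a : A) (s : restr_ring phi) => tens (s : S_R) (tens x a)).
Proof.
split=> [a a' s|a s s'|c a s]; first by rewrite !tensDr.
- by rewrite tensDl.
- by rewrite tensZr tensZ.
Qed.

Definition unshuffle_at (x : M) : bc A -> tensor S_R (tensor M A) :=
  tensor_bilift (balanced_unshuffle_at x).
HB.instance Definition _ x := GRing.Additive.on (unshuffle_at x).

Lemma unshuffle_at_tens x a s :
  unshuffle_at x (a ⊠ s) = tens (s : S_R) (tens x a).
Proof. exact: tensor_bilift_tens. Qed.

Fact balanced_unshuffle :
  balanced (fun (x : M) (w : res (bc A)) => unshuffle_at x w).
Proof.
split=> [x x' w|x w w'|c x w]; last 2 first.
- exact: raddfD.
- apply: (base_change_ext (f := unshuffle_at (c *: x))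
    (g := unshuffle_at x \o ( *:%R (phi c)))) w => a s /=.
  by rewrite base_changeZ !unshuffle_at_tens tensZl -tensZ.
apply: (base_change_ext (f := unshuffle_at (x + x'))
  (g := unshuffle_at x \+ unshuffle_at x')) w => a s /=.
by rewrite !unshuffle_at_tens tensDl tensDr.
Qed.

Definition unshuffle : tensor M (res (bc A)) -> tensor S_R (tensor M A) :=
  tensor_bilift balanced_unshuffle.
HB.instance Definition _ := GRing.Additive.on unshuffle.

Lemma unshuffle_tens x a s :
  unshuffle (tens x (a ⊠ s : res (bc A))) = tens (s : S_R) (tens x a).
Proof. by rewrite /unshuffle tensor_bilift_tens unshuffle_at_tens. Qed.

Lemma shuffleK : cancel shuffle unshuffle.
Proof.
apply: (tensor_ext_assoc (f := unshuffle \o shuffle) (g := idfun)) => s x a /=.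
by rewrite shuffle_tens unshuffle_tens.
Qed.

Lemma unshuffleK : cancel unshuffle shuffle.
Proof.
apply: (tensor_ext (f := shuffle \o unshuffle) (g := idfun)) => x w.
elim/tensor_ind_tens: w => [|a s w IHw]; first by rewrite tens0r !raddf0.
rewrite tensDr !raddfD IHw /=; congr (_ + _).
by rewrite unshuffle_tens shuffle_tens.
Qed.

End Shuffle.

(** * The unit of base change *)

Section Unit.
Variable Q : lmodType R.

Definition base_change_unit (q : Q) : res (bc Q) := q ⊠ 1.

Fact base_change_unit_linear : linear base_change_unit.
Proof.
move=> a q q'.
by rewrite /base_change_unit base_change_tensDl base_change_tensZ.
Qed.

HB.instance Definition _ :=
  GRing.isLinear.Build R Q (res (bc Q)) _ base_change_unit
    base_change_unit_linear.

(** After tensoring with [S], the unit has the retraction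
    [s (x) (q (x) t) |-> s * t (x) q]; the next maps build it for a fixed [s],
    then as a function of [s]. *)
Fact balanced_unit_retract_at (s : S) :
  balanced (fun (q : Q) (s' : restr_ring phi) => tens (s * s' : S_R) q).
Proof.
split=> [q q' t|q t t'|c q t]; first by rewrite tensDr.
- by rewrite mulrDr tensDl.
- by rewrite -tensZ !restr_ringZ mulrCA.
Qed.

Definition unit_retract_at (s : S) : bc Q -> tensor S_R Q :=
  tensor_bilift (balanced_unit_retract_at s).
HB.instance Definition _ s := GRing.Additive.on (unit_retract_at s).

Lemma unit_retract_at_tens s q t :
  unit_retract_at s (q ⊠ t) = tens (s * t : S_R) q.
Proof. exact: tensor_bilift_tens. Qed.

Fact balanced_unit_retract :
  balanced (fun (s : restr_ring phi) (w : res (bc Q)) => unit_retract_at s w).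
Proof.
split=> [s s' w|s w w'|c s w]; last 2 first.
- exact: raddfD.
- apply: (base_change_ext (f := unit_retract_at (c *: s))
    (g := unit_retract_at s \o ( *:%R (phi c)))) w => q t /=.
  by rewrite base_changeZ !unit_retract_at_tens restr_ringZ mulrCA mulrA.
apply: (base_change_ext (f := unit_retract_at (s + s'))
  (g := unit_retract_at s \+ unit_retract_at s')) w => q t /=.
by rewrite !unit_retract_at_tens mulrDl tensDl.
Qed.

(** The unit becomes a split injection after tensoring with [S], and faithful
    flatness reflects injectivity. *)
Lemma base_change_unit_inj :
  faithfully_flat S_R -> injective base_change_unit.
Proof.
move=> ffS; apply: (faithfully_flat_inj ffS).
apply: (can_inj (g := tensor_bilift balanced_unit_retract)).
apply: (tensor_ext (f := tensor_bilift balanced_unit_retract \o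
  tensor_map S_R base_change_unit) (g := idfun)) => s q /=.
rewrite tensor_map_tens tensor_bilift_tens.
by rewrite /base_change_unit unit_retract_at_tens mulr1.
Qed.

End Unit.

(** * Descent *)

(** Flatness of [S] gives exactness with [S] as the left factor, base change puts
    it on the right. *)
Lemma base_change_exact (A B C : lmodType R) (f : {linear A -> B})
    (g : {linear B -> C}) : flat S_R -> exact_at f g ->
  exact_at (base_change_map f : {linear bc A -> bc B})
           (base_change_map g : {linear bc B -> bc C}).
Proof.
move=> flatS /flatS.
have swap_bij (D : lmodType R) : bijective (tensor_swap S_R D : _ -> bc D).
  by exists (tensor_swap D S_R); exact: tensor_swapK.
have swap_nat (D E : lmodType R) (h : {linear D -> E}) u :
    base_change_map h (tensor_swap S_R D u)
    = tensor_swap S_R E (tensor_map S_R h u).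
  apply: (tensor_ext (f := base_change_map h \o tensor_swap S_R D)
    (g := tensor_swap S_R E \o tensor_map S_R h)) u => s x /=.
  rewrite tensor_map_tens !tensor_swap_tens; exact: base_change_map_tens.
have swap0 : (tensor_swap S_R C : _ -> bc C) 0 = 0 := raddf0 (tensor_swap S_R C).
exact: (iffLR (exact_at_bij (swap_bij A) (swap_bij B) (swap_bij C) swap0
  (swap_nat _ _ f) (swap_nat _ _ g))).
Qed.

(** The base-changed sequence tensored with [M_S] is the original one tensored
    with [M], then with [S]. *)
Lemma flat_descent (M : lmodType R) :
  faithfully_flat S_R -> flat (bc M) -> flat M.
Proof.
move=> ffS flatMS A B C f g fg; apply/ffS.
have /flatMS := base_change_exact (faithfully_flat_flat ffS) fg.
pose th (D : lmodType R) := @base_change_cancel M (bc D) \o @shuffle M D.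
have th_bij D : bijective (th D).
  by apply: bij_comp; [exists (@base_change_uncancel M (bc D)) |
    exists (@unshuffle M D)]; do [exact: base_change_cancelK |
    exact: base_change_uncancelK | exact: shuffleK | exact: unshuffleK].
have th_nat (D E : lmodType R) (h : {linear D -> E}) u :
    tensor_map (bc M) (base_change_map h) (th D u)
    = th E (tensor_map S_R (tensor_map M h) u).
  apply: (tensor_ext_assoc
    (f := tensor_map (bc M) (base_change_map h) \o th D)
    (g := th E \o tensor_map S_R (tensor_map M h))) u => s x a /=.
  rewrite /th /= tensor_map_tens /= tensor_map_tens !shuffle_tens.
  by rewrite !base_change_cancel_tens tensor_map_tens /= base_change_map_tens.
have th0 : th C 0 = 0 := raddf0 (@base_change_cancel M (bc C) \o @shuffle M C).
exact: (iffRL (exact_at_bij (th_bij A) (th_bij B) (th_bij C) th0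
  (th_nat _ _ f) (th_nat _ _ g))).
Qed.

Section ProductUnit.
Variables (I : Type) (Q : I -> lmodType R).

Definition prod_base_change_unit (e : prod_module Q) :
  res (prod_module (fun i => bc (Q i))) := fun i => base_change_unit (e i).

Fact prod_base_change_unit_linear : linear prod_base_change_unit.
Proof.
by move=> a e e'; apply: functional_extensionality_dep => i; exact: linearP.
Qed.

HB.instance Definition _ :=
  GRing.isLinear.Build R (prod_module Q) (res (prod_module (fun i => bc (Q i))))
    _ prod_base_change_unit prod_base_change_unit_linear.

Lemma prod_base_change_unit_inj :
  faithfully_flat S_R -> injective prod_base_change_unit.
Proof.
move=> ffS e e' ee'; apply: functional_extensionality_dep => i.
apply: (base_change_unit_inj ffS).
exact: (congr1 (fun h : prod_module (fun i => bc (Q i)) => h i) ee').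
Qed.

End ProductUnit.

(** The map from [M (x) prod Q_i] to the product of the [M (x) Q_i] is the first
    factor of an injective map. *)
Lemma mittag_leffler_descent (cQ : lmodType R -> Prop) (M : lmodType R) :
  faithfully_flat S_R -> flat M ->
  mittag_leffler (bc M) (base_change_class phi cQ) -> mittag_leffler M cQ.
Proof.
move=> ffS flatM mlMS I Q cQQ.
(* Everything is compared inside the product of the M_S (x)_S (Q_i)_S. *)
have mapMS_inj : injective (tensor_prod_map (bc M) (fun i => bc (Q i))).
  by apply: mlMS => i; exists (Q i).
pose to_MS u := base_change_cancel (tensor_map M (@prod_base_change_unit I Q) u).
have to_MS_inj : injective to_MS.
  apply: inj_comp; first exact: can_inj (@base_change_cancelK _ _).
  apply: (flat_inj flatM); exact: prod_base_change_unit_inj.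
have square u i : tensor_prod_map (bc M) (fun i => bc (Q i)) (to_MS u) i
    = base_change_cancel (tensor_map M (@base_change_unit (Q i))
        (tensor_prod_map M Q u i)).
  elim/tensor_ind_tens: u => [|x e u IHu]; first by rewrite /to_MS !raddf0.
  rewrite /to_MS !raddfD /= -/(to_MS u) prod_moduleD IHu.
  congr (_ + _); rewrite !tensor_map_tens tensor_prod_map_tens.
  by rewrite tensor_map_tens !base_change_cancel_tens tensor_prod_map_tens.
move=> u v uv; apply/to_MS_inj/mapMS_inj.
by apply: functional_extensionality_dep => i; rewrite !square uv.
Qed.

End BaseChange.

Theorem theorem3p8 (R S : comPzRingType) (phi : {rmorphism R -> S})
    (cQ : lmodType R -> Prop) (M : lmodType R) :
  faithfully_flat_morphism phi ->
  flat (base_change phi M : lmodType S) ->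
  mittag_leffler (base_change phi M : lmodType S) (base_change_class phi cQ) ->
  flat M /\ mittag_leffler M cQ.
Proof.
move=> ffS flatMS mlMS; have flatM := flat_descent ffS flatMS.
by split=> //; exact: mittag_leffler_descent mlMS.
Qed.
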